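(* For every $n\ge 1$ there is a bijection $\psi$ between the set $\mathcal{DU}_{2n-1}(4123)$ and the set of skew Yamanouchi words on the alphabet $\{1,2,3\}$ of type $(n-1,n,n+1)$ such that, for every $\pi=\pi_1\pi_2\ldots\pi_{2n-1}\in\mathcal{DU}_{2n-1}(4123)$, one has $\pi_1=\alpha(\psi(\pi))$ and $\mathcal{A}(\pi)=\mathcal{B}(\psi(\pi))$.
   Context: A permutation $\pi=\pi_1\cdots\pi_m$ of $[m]=\{1,\ldots,m\}$ is down-up alternating if $\pi_1>\pi_2<\pi_3>\pi_4<\cdots$; it avoids the pattern $4123$ if no subsequence $\pi_{i_1}\pi_{i_2}\pi_{i_3}\pi_{i_4}$ ($i_1<i_2<i_3<i_4$) satisfies $\pi_{i_2}<\pi_{i_3}<\pi_{i_4}<\pi_{i_1}$. $\mathcal{DU}_m(4123)$ is the set of $4123$-avoiding down-up alternating permutations of $[m]$. A word $w$ on $\{1,2,3\}$ has type $(c_1,c_2,c_3)$ if $c_i$ letters equal $i$. A word $w=w_1\cdots w_{3n}$ of type $(n-1,n,n+1)$ is a skew Yamanouchi word if, writing $a_1<\cdots<a_{n-1}$, $b_1<\cdots<b_n$, $c_1<\cdots<c_{n+1}$ for the positions of the letters $1$, $2$, $3$ respectively, one has $b_n<c_n$ and $a_j<b_j<c_j$ for all $1\le j\le n-1$. For a word $w$ containing a $3$, $\alpha(w)=j$ where $w_{j+1}$ is the leftmost letter of $w$ equal to $3$ (the length of the initial run). Define $\mathcal{A}(\pi)=\{0\}\cup\{k : \exists\, i<j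 \text{ with } \pi_i=k,\ \pi_j=k+1,\ k\le\pi_1-2\}$ for a permutation $\pi$, and $\mathcal{B}(w)=\{0\}\cup\{k : w_kw_{k+1}=12 \text{ and } k\le\alpha(w)-2\}$ for a word $w$. *)

(* Defs.v *)
From mathcomp Require Import all_boot all_fingroup.

Set Implicit Arguments.
Unset Strict Implicit.
Unset Printing Implicit Defensive.

(* A permutation of [m] = {1, ..., m} is an element of 'S_m; both positions and
   values of 'S_m start at 0, so that the one-line entry pi_(i+1) is (pi i).+1. *)

(* Positions are counted from 0: the descents are at the even i. *)
Definition down_up m (pi : 'S_m) : bool :=
  [forall i : 'I_m, forall j : 'I_m, (j == i.+1 :> nat) ==>
     (if odd i then pi i < pi j else pi j < pi i)].

Definition contains4123 m (pi : 'S_m) : bool :=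
  [exists i1 : 'I_m, exists i2 : 'I_m, exists i3 : 'I_m, exists i4 : 'I_m,
     [&& i1 < i2, i2 < i3, i3 < i4,
         pi i2 < pi i3, pi i3 < pi i4 & pi i4 < pi i1]].

Definition DU4123 m : {set 'S_m} :=
  [set pi : 'S_m | down_up pi && ~~ contains4123 pi].

Definition one_line m (pi : 'S_m) : seq nat := [seq (pi i).+1 | i : 'I_m].

(* The first entry pi_1; the default value 0 is only taken for m = 0. *)
Definition first_entry m (pi : 'S_m) : nat := head 0 (one_line pi).

(* k <= pi_1 - 2 is written without truncated subtraction. *)
Definition setA m (pi : 'S_m) : {pred nat} :=
  [pred k : nat | (k == 0) ||
     [exists i : 'I_m, exists j : 'I_m,
        [&& i < j, (pi i).+1 == k, (pi j).+1 == k.+1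
          & k + 2 <= first_entry pi]]].

Definition has_type (c1 c2 c3 : nat) (w : seq nat) : bool :=
  [&& all (fun x => x \in [:: 1; 2; 3]) w,
      count_mem 1 w == c1, count_mem 2 w == c2 & count_mem 3 w == c3].

(* The increasing list of the positions (from 0) of the letter x in w. *)
Definition positions (x : nat) (w : seq nat) : seq nat :=
  [seq i <- iota 0 (size w) | nth 0 w i == x].

(* a_j, b_j, c_j are the entries of index j.-1 of the lists a, b, c; all the
   indices used are in range when n >= 1 and w has type (n-1, n, n+1). *)
Definition skew_yamanouchi (n : nat) (w : seq nat) : bool :=
  let a := positions 1 w in
  let b := positions 2 w in
  let c := positions 3 w in
  [&& has_type (n - 1) n (n + 1) w,
      nth 0 b n.-1 < nth 0 c n.-1
    & [forall j : 'I_(n - 1),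
         (nth 0 a j < nth 0 b j) && (nth 0 b j < nth 0 c j)]].

(* index counts from 0, so it is the number of letters before the leftmost 3. *)
Definition alpha (w : seq nat) : nat := index 3 w.

(* w_k and w_(k+1), counted from 1, are nth 0 w k.-1 and nth 0 w k. *)
Definition setB (w : seq nat) : {pred nat} :=
  [pred k : nat | (k == 0) ||
     [&& 1 <= k, nth 0 w k.-1 == 1, nth 0 w k == 2 & k + 2 <= alpha w]].

(* Main.v *)
Require Import Defs.
From mathcomp Require Import all_boot all_fingroup zify.

Set Implicit Arguments.
Unset Strict Implicit.
Unset Printing Implicit Defensive.

(** Both families grow along the same generating tree.  Label a permutation pi by
    (pi_1, A(pi)) and a word w by (alpha(w), B(w)).  An object with label (p, A)
    has one child for each pair (u, v) such that v <= u <= p, v < p and no k in A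
    satisfies v < k < u; the child has label
    (u + 2, {0} U {k in A | k < v} U {v + 1 | v < u}).
    - The child of a permutation is obtained by prepending the two entries u + 2
      and v + 1 and shifting the others up.  Alternation forces v < p.  Avoiding
      4123 forces u <= p and makes the values strictly between the two new entries
      appear in decreasing order, that is, no k in A lies strictly between v and u.
    - The child of the word x y z, where |x| = v, |x y| = u and x y contains no 3,
      is x 1 2 y 3 z.  Conversely one deletes the first 3 and the last factor 12
      of the initial run or, if that run is followed by 33, the last factor 12
      not using the final letter of the run. *)

(** * Generating trees *)

Lemma fin_relation_bijection (S : finType) (T : eqType) (M : S -> T -> Prop) :
  (forall x, exists y, M x y) -> (forall y, exists x, M x y) ->
  (forall x y y', M x y -> M x y' -> y = y') ->
  (forall x x' y, M x y -> M x' y -> x = x') ->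
  exists psi : S -> T, bijective psi /\ forall x, M x (psi x).
Proof.
move=> /fin_all_exists[psi Mpsi] M_surj M_fun M_inj.
have psi_surj y : exists x, psi x == y.
  by have [x Mxy] := M_surj y; exists x; apply/eqP/(M_fun x).
pose phi y := xchoose (psi_surj y).
have phiK : cancel phi psi by move=> y; apply/eqP/(xchooseP (psi_surj y)).
exists psi; split=> //; exists phi => // x.
by apply: (M_inj _ _ (psi x)) => //; rewrite -{2}[psi x]phiK.
Qed.

Section GeneratingTrees.
Variable C : Type.

(* The carrier may contain elements outside the tree: they lie on no level. *)
Record gen_tree := GenTree {
  node : Type;
  root : node;
  level : nat -> node -> Prop;
  admits : node -> C -> Prop;
  child : node -> C -> node;
  level0P : forall t, level 0 t <-> t = root;
  level_child : forall n t c, level n t -> admits t c -> level n.+1 (child t c);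
  level_parent : forall n t', level n.+1 t' ->
    exists t c, [/\ level n t, admits t c & t' = child t c];
  child_inj : forall n t c t' c', level n t -> admits t c ->
    level n t' -> admits t' c' -> child t c = child t' c' -> t = t' /\ c = c'
}.

Implicit Types G H : gen_tree.

(* The sequence s lists the choices from the last one to the first one. *)
Definition descend G (s : seq C) : node G :=
  foldr (fun c t => child t c) (root G) s.

Fixpoint valid G (s : seq C) : Prop :=
  if s is c :: s' then valid G s' /\ admits (descend G s') c else True.

Lemma level_descend G s : valid G s -> level (size s) (descend G s).
Proof.
elim: s => [|c s IHs] /=; first by move=> _; apply/level0P.
by case=> /IHs lev adm; apply: level_child.
Qed.

Lemma descend_surj G n t : level n t ->
  exists s, [/\ valid G s, size s = n & descend G s = t].
Proof.
elim: n t => [|n IHn] t; first by move/level0P->; exists [::].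
case/level_parent=> t' [c [/IHn[s [val_s size_s descend_s]] adm ->]].
by exists (c :: s); rewrite /= size_s descend_s.
Qed.

Lemma descend_inj G s s' : valid G s -> valid G s' -> size s = size s' ->
  descend G s = descend G s' -> s = s'.
Proof.
elim: s s' => [|c s IHs] [|c' s'] //= [val_s adm] [val_s' adm'] [eq_size].
have lev' : level (size s) (descend G s') by rewrite eq_size; apply: level_descend.
case/(child_inj (level_descend val_s) adm lev' adm') => eq_descend ->.
by rewrite (IHs s').
Qed.

Record bisimulation G H (R : node G -> node H -> Prop) := Bisimulation {
  bisim_root : R (root G) (root H);
  bisim_admits : forall t t' c, R t t' -> (admits t c <-> admits t' c);
  bisim_child : forall n t t' c, level n t -> level n t' -> admits t c ->
    admits t' c -> R t t' -> R (child t c) (child t' c)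
}.

Lemma bisim_sym G H (R : node G -> node H -> Prop) :
  bisimulation R -> bisimulation (fun t' t => R t t').
Proof.
case=> R_root R_admits R_child; split=> // [t t' c Rtt'|n t t' c *].
  exact: iff_sym (R_admits _ _ c Rtt').
exact: (R_child n).
Qed.

Lemma bisim_descend G H (R : node G -> node H -> Prop) s : bisimulation R ->
  valid G s -> valid H s /\ R (descend G s) (descend H s).
Proof.
move=> bisR; elim: s => [|c s IHs] /=; first by split=> //; apply: bisim_root.
case=> val_s adm; have [val_s' Rs] := IHs val_s.
have adm' := (bisim_admits bisR c Rs).1 adm; split=> //.
by apply: (bisim_child bisR) Rs => //; apply: level_descend.
Qed.

Definition corresponding G H n (t : node G) (t' : node H) : Prop :=
  exists s, [/\ valid G s, valid H s, size s = n, descend G s = t & descend H s = t'].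

Lemma corresponding_sym G H n (t : node G) (t' : node H) :
  corresponding n t t' -> corresponding n t' t.
Proof. by case=> s [? ? ? ? ?]; exists s. Qed.

Lemma corresponding_level G H n (t : node G) (t' : node H) :
  corresponding n t t' -> level n t.
Proof. by case=> s [val_s _ <- <- _]; apply: level_descend. Qed.

Lemma corresponding_fun G H n (t : node G) (t1 t2 : node H) :
  corresponding n t t1 -> corresponding n t t2 -> t1 = t2.
Proof.
move=> [s [val_s _ <- <- <-]] [s' [val_s' _ eq_size eq_descend <-]].
by rewrite (descend_inj val_s' val_s).
Qed.

Lemma corresponding_total G H (R : node G -> node H -> Prop) n (t : node G) :
  bisimulation R -> level n t -> exists t' : node H, corresponding n t t'.
Proof.
move=> bisR /descend_surj[s [val_s size_s descend_s]].
by exists (descend H s), s; have [] := bisim_descend bisR val_s.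
Qed.

Lemma corresponding_bisim G H (R : node G -> node H -> Prop) n t t' :
  bisimulation R -> corresponding n t t' -> R t t'.
Proof. by move=> bisR [s [/(bisim_descend bisR)[_ Rs] _ _ <- <-]]. Qed.

Theorem bisim_level_bijection G H (R : node G -> node H -> Prop) n
    (S : finType) (T : eqType) (f : S -> node G) (g : T -> node H) :
  bisimulation R -> injective f -> injective g ->
  (forall t, level n t <-> exists x, f x = t) ->
  (forall t, level n t <-> exists y, g y = t) ->
  exists psi : S -> T, bijective psi /\ forall x, R (f x) (g (psi x)).
Proof.
move=> bisR f_inj g_inj fP gP.
have [psi [psi_bij psiP]] : exists psi : S -> T,
    bijective psi /\ forall x, corresponding n (f x) (g (psi x)).
  apply: (@fin_relation_bijection _ _ (fun x y => corresponding n (f x) (g y))).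
  - move=> x; have /(corresponding_total bisR)[t' ftt'] : level n (f x).
      by apply/fP; exists x.
    have /gP[y gy] := corresponding_level (corresponding_sym ftt').
    by exists y; rewrite gy.
  - move=> y; have /(corresponding_total (bisim_sym bisR))[t gtt'] : level n (g y).
      by apply/gP; exists y.
    have /corresponding_sym := gtt'.
    by have /fP[x <-] := corresponding_level (corresponding_sym gtt'); exists x.
  - by move=> x y y' xy /(corresponding_fun xy)/g_inj.
  - move=> x x' y /corresponding_sym yx /corresponding_sym yx'.
    exact/f_inj/(corresponding_fun yx yx').
by exists psi; split=> // x; apply: (corresponding_bisim bisR) (psiP x).
Qed.

End GeneratingTrees.

(** * The succession rule *)

Definition admissible (p : nat) (A : pred nat) (c : nat * nat) : Prop :=
  let: (u, v) := c in [/\ v <= u, u <= p, v < p & forall k, v < k < u -> ~~ A k].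

Definition child_set (A : pred nat) (c : nat * nat) : pred nat :=
  let: (u, v) := c in fun k => [|| k == 0, (k < v) && A k | (v < u) && (k == v.+1)].

Lemma eq_admissible p A B c : A =1 B -> (admissible p A c <-> admissible p B c).
Proof.
by case: c => u v eqAB; split=> -[? ? ? noA]; split=> // k /noA; rewrite eqAB.
Qed.

Lemma eq_child_set A B c : A =1 B -> child_set A c =1 child_set B c.
Proof. by case: c => u v eqAB k; rewrite /child_set eqAB. Qed.

(** * Subsequences *)

Section Subsequences.
Variables T T' : eqType.
Implicit Types (s : seq T) (f : T -> T').

Lemma subseq_cons2 x y s s' :
  subseq (x :: s) (y :: s') = (x == y) && subseq s s' || subseq (x :: s) s'.
Proof.
rewrite /=; case: eqP => [->|] //=; apply/esym/orb_idr => /=.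
exact/subseq_trans/subseq_cons.
Qed.

Lemma subseq_mapP f l s :
  reflect (exists2 l', subseq l' s & l = map f l') (subseq l (map f s)).
Proof.
apply: (iffP idP) => [/subseqP[m _ ->]|[l' sub_s ->]]; last exact: map_subseq.
by exists (mask m s); rewrite ?mask_subseq ?map_mask.
Qed.

Lemma subseq_map_inj f l s : injective f -> subseq (map f l) (map f s) = subseq l s.
Proof.
move=> f_inj; apply/idP/idP; last exact: map_subseq.
by case/subseq_mapP=> l' sub_s /(inj_map f_inj)->.
Qed.

Lemma subseq2_index x y s :
  uniq s -> subseq [:: x; y] s = (index x s < index y s < size s).
Proof.
elim: s => //= z s IHs /andP[z_s /IHs{}IHs]; rewrite [x == z]eq_sym.
have [eq_zy|_] := eqVneq z y; last by case: ifP; rewrite ?sub1seq ?IHs !ltnS ?index_mem.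
rewrite -eq_zy in IHs *; rewrite ltn0.
by case: ifP; rewrite ?sub1seq ?IHs ?index_mem (negPf z_s) ?andbF.
Qed.

Lemma subseq2_neq_head x0 x y s : uniq s -> subseq [:: x; y] s -> y != head x0 s.
Proof.
move=> Us; rewrite subseq2_index //; case: s Us => //= p s _.
by rewrite [p == y]eq_sym; case: (y == p).
Qed.

Lemma subseq_head x0 x s :
  x \in s -> x != head x0 s -> subseq [:: head x0 s; x] s.
Proof.
case: s => //= p s; rewrite inE eqxx sub1seq => /predU1P[->|//].
by rewrite eqxx.
Qed.

End Subsequences.

(** * Alternating 4123-avoiding sequences *)

Lemma perm_iota1P m (s : seq nat) :
  reflect (uniq s /\ forall x, (x \in s) = (0 < x <= m)) (perm_eq s (iota 1 m)).
Proof.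
have mem_iota1 x : (x \in iota 1 m) = (0 < x <= m) by rewrite mem_iota add1n ltnS.
apply: (iffP idP) => [perm_s|[Us mem_s]].
  by split=> [|x]; rewrite ?(perm_uniq perm_s) ?iota_uniq ?(perm_mem perm_s).
by apply: uniq_perm => // [|x]; rewrite ?iota_uniq // mem_s mem_iota1.
Qed.

Lemma subseq_consecutive (s : seq nat) x y :
  uniq s -> (forall z, x <= z <= y -> z \in s) -> x < y -> subseq [:: x; y] s ->
  exists2 k, x <= k < y & subseq [:: k; k.+1] s.
Proof.
move=> Us; elim: y => // y IHy mem_s; rewrite ltnS leq_eqVlt => /orP[/eqP<-|lt_xy].
  by exists x; rewrite ?leqnn.
rewrite subseq2_index // => idx_xy.
have [sub_y|/negPf no_sub_y] := boolP (subseq [:: y; y.+1] s).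
  by exists y => //; lia.
have [k k_range sub_k] : exists2 k, x <= k < y & subseq [:: k; k.+1] s.
  apply: IHy => // [z z_range|]; first by apply: mem_s; lia.
  have [y_s y1_s] : y \in s /\ y.+1 \in s by split; apply: mem_s; lia.
  have neq_idx : index y s != index y.+1 s by apply/eqP => /(index_inj 0 y_s y1_s); lia.
  by move: no_sub_y y_s; rewrite !subseq2_index // -index_mem; lia.
by exists k => //; lia.
Qed.

Definition prepend (h : nat) (s : seq nat) : seq nat := h :: map (bump h) s.

Lemma bump_inj h : injective (bump h).
Proof. exact: can_inj (bumpK h). Qed.

Lemma ltn_bump2 h x y : (bump h x < bump h y) = (x < y).
Proof. by rewrite !ltnNge leq_bump2. Qed.

Lemma prepend_inj h s h' s' : prepend h s = prepend h' s' -> h = h' /\ s = s'.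
Proof. by case=> <- /(inj_map (@bump_inj h)). Qed.

Lemma prepend_unbump x s : x \notin s -> prepend x (map (unbump x) s) = x :: s.
Proof.
move=> x_s; congr (_ :: _); rewrite -map_comp; apply: map_id_in => y y_s /=.
by apply: unbumpK; rewrite inE; apply: contraNneq x_s => <-.
Qed.

Lemma mem_prepend_bump h x s : (bump h x \in prepend h s) = (x \in s).
Proof. by rewrite inE eq_sym (negPf (neq_bump h x)) (mem_map (@bump_inj h)). Qed.

Lemma prepend_uniq h s : uniq (prepend h s) = uniq s.
Proof.
rewrite /= (map_inj_uniq (@bump_inj h)); case: mapP => // -[x _ h_x].
by move: (neq_bump h x); rewrite -h_x eqxx.
Qed.

Lemma prepend_perm_iota1 h m s :
  perm_eq (prepend h s) (iota 1 m.+1) = (0 < h <= m.+1) && perm_eq s (iota 1 m).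
Proof.
apply/perm_iota1P/andP; rewrite prepend_uniq.
  case=> Us mem_hs; have h_range : 0 < h <= m.+1 by rewrite -mem_hs mem_head.
  split=> //; apply/perm_iota1P; split=> // x.
  by rewrite -(mem_prepend_bump h) mem_hs /bump; lia.
case=> h_range /perm_iota1P[Us mem_s]; split=> // y.
have [->|neq_yh] := eqVneq y h; first by rewrite mem_head h_range.
rewrite -(unbumpK (_ : y \in predC1 h)) // mem_prepend_bump mem_s /bump; lia.
Qed.

Fixpoint alternates (down : bool) (s : seq nat) : bool :=
  if s is x :: s' then
    (if s' is y :: _ then if down then y < x else x < y else true)
    && alternates (~~ down) s'
  else true.

Lemma alternates_map down (f : nat -> nat) s : {mono f : x y / x < y} ->
  alternates down (map f s) = alternates down s.
Proof.
by move=> f_mono; elim: s down => //= x [|y s] IHs down //; rewrite -IHs /= !f_mono.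
Qed.

Lemma alternatesP down s :
  reflect (forall i, i.+1 < size s -> if odd i (+) down then nth 0 s i.+1 < nth 0 s i
                                      else nth 0 s i < nth 0 s i.+1)
          (alternates down s).
Proof.
elim: s down => [|x [|y s] IHs] down; [by left.. |].
apply: (iffP andP) => [[lt_xy /IHs alt_s] [|i] //= lt_i|alt_s].
  by have := alt_s i lt_i; rewrite addNb addbN.
split; first exact: (alt_s 0).
by apply/IHs => i lt_i; rewrite addbN -addNb; apply: (alt_s i.+1).
Qed.

Definition avoids4123 (s : seq nat) : Prop :=
  forall a b c d, subseq [:: a; b; c; d] s -> ~~ [&& b < c, c < d & d < a].

Definition avoids123_below (h : nat) (s : seq nat) : Prop :=
  forall b c d, subseq [:: b; c; d] s -> ~~ [&& b < c, c < d & d < h].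

Definition avoids12_between (g h : nat) (s : seq nat) : Prop :=
  forall c d, subseq [:: c; d] s -> ~~ [&& g <= c, c < d & d < h].

Lemma avoids4123_prepend h s :
  avoids4123 (prepend h s) <-> avoids4123 s /\ avoids123_below h s.
Proof.
split=> [av|[av av_h] a b c d].
  split=> [a b c d|b c d] /(map_subseq (bump h)) sub_s.
    by have := av _ _ _ _ (subseq_trans sub_s (subseq_cons _ _)); rewrite !ltn_bump2.
  have := av h (bump h b) (bump h c) (bump h d); rewrite /= eqxx => /(_ sub_s).
  by rewrite /bump; lia.
rewrite subseq_cons2 => /orP[/andP[/eqP->]|] /subseq_mapP[].
  by case=> [|b' [|c' [|d' []]]] //= /av_h av_bcd [-> -> ->]; rewrite /bump; lia.
by case=> [|a' [|b' [|c' [|d' []]]]] //= /av av_abcd [-> -> -> ->]; rewrite !ltn_bump2.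
Qed.

Lemma avoids123_below_prepend g h s : g <= h ->
  avoids123_below h.+1 (prepend g s) <-> avoids123_below h s /\ avoids12_between g h s.
Proof.
move=> le_gh; split=> [av|[av av12] b c d].
  split=> [b c d|c d] /(map_subseq (bump g)) sub_s.
    have := av _ _ _ (subseq_trans sub_s (subseq_cons _ _)).
    by rewrite !ltn_bump2 /bump; lia.
  have := av g (bump g c) (bump g d); rewrite /= eqxx => /(_ sub_s).
  by rewrite ltn_bump2 /bump; lia.
rewrite subseq_cons2 => /orP[/andP[/eqP->]|] /subseq_mapP[].
  case=> [|c' [|d' []]] //= /av12 av_cd [-> ->].
  by rewrite ltn_bump2 /bump; lia.
case=> [|b' [|c' [|d' []]]] //= /av av_bcd [-> -> ->].
by rewrite !ltn_bump2 /bump; lia.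
Qed.

(* A 123 in values at most the first entry extends to a 4123 by that entry. *)
Lemma avoids4123_below_head h s : uniq s -> avoids4123 s -> h <= (head 0 s).+1 ->
  avoids123_below h s.
Proof.
case: s => [|p s] /=; first by move=> _ _ _ [].
case/andP=> p_s _ av le_hp b c d; rewrite subseq_cons2 => /orP[/andP[/eqP->]|sub_s].
  by lia.
have d_s : d \in s by apply: (mem_subseq sub_s); rewrite !inE eqxx !orbT.
have neq_dp : d != p by apply: contraNneq p_s => <-.
by have := av p b c d; rewrite subseq_cons2 eqxx sub_s => /(_ isT); lia.
Qed.

Definition ascents (s : seq nat) : pred nat :=
  fun k => (k == 0) || subseq [:: k; k.+1] s && (k + 2 <= head 0 s).

Lemma avoids12_between_ascents v u s : uniq s -> (forall x, v < x <= u -> x \in s) ->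
  u <= head 0 s ->
  avoids12_between v.+1 u.+1 s <-> forall k, v < k < u -> ~~ ascents s k.
Proof.
move=> Us mem_s le_up; split=> [av k k_range|no_asc c d sub_s].
  by apply/norP; split; [|apply/andP => -[/av]]; lia.
apply/negP => /and3P[lt_vc lt_cd lt_du].
have [z z_range|k k_range sub_k] := subseq_consecutive Us _ lt_cd sub_s.
  by apply: mem_s; lia.
have neq_kp : _ != head 0 s := subseq2_neq_head 0 Us sub_k.
by have := no_asc k; rewrite /ascents sub_k; lia.
Qed.

Definition du4123 (m : nat) (s : seq nat) : Prop :=
  [/\ perm_eq s (iota 1 m), alternates true s & avoids4123 s].

Definition perm_ins (s : seq nat) (c : nat * nat) : seq nat :=
  let: (u, v) := c in prepend u.+2 (prepend v.+1 s).

Definition bump2 (u v x : nat) : nat := bump u.+2 (bump v.+1 x).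

Lemma perm_insE s u v : v <= u ->
  perm_ins s (u, v) = u.+2 :: v.+1 :: map (bump2 u v) s.
Proof.
move=> le_vu; rewrite /perm_ins /prepend /= -map_comp; congr [:: _, _ & _].
by rewrite /bump; lia.
Qed.

Lemma perm_ins_inj s c s' c' : perm_ins s c = perm_ins s' c' -> s = s' /\ c = c'.
Proof.
case: c c' => [u v] [u' v'] /prepend_inj[[->] /prepend_inj[[->] ->]].
by [].
Qed.

Lemma alternates_perm_ins s u v : v <= u -> 0 < size s ->
  alternates true (perm_ins s (u, v)) = (v < head 0 s) && alternates true s.
Proof.
move=> le_vu; rewrite perm_insE //; case: s => // p s _.
rewrite [LHS]/= -[_ && alternates _ _]/(alternates true (map (bump2 u v) (p :: s))).
rewrite alternates_map => [|x y]; last by rewrite /bump2 !ltn_bump2.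
by rewrite /= /bump2 /bump; lia.
Qed.

Lemma avoids4123_perm_ins s u v : uniq s -> (forall x, v < x <= u -> x \in s) ->
  v <= u -> v < head 0 s ->
  avoids4123 (perm_ins s (u, v)) <->
  avoids4123 s /\ admissible (head 0 s) (ascents s) (u, v).
Proof.
move=> Us mem_s le_vu lt_vp.
split=> [/avoids4123_prepend[/avoids4123_prepend[av _]]|[av [_ le_up _ no_asc]]].
  case/avoids123_below_prepend=> // _ av12; split=> //.
  have le_up : u <= head 0 s.
    rewrite leqNgt; apply/negP => lt_pu.
    have sub_pu : subseq [:: head 0 s; u] s.
      apply: subseq_head; last by rewrite gtn_eqF.
      by apply: mem_s; rewrite leqnn (ltn_trans lt_vp).
    by have := av12 _ _ sub_pu; lia.
  by split=> //; apply/avoids12_between_ascents.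
apply/avoids4123_prepend; split.
  apply/avoids4123_prepend; split=> //.
  by apply: avoids4123_below_head; rewrite // ltnS ltnW.
apply/avoids123_below_prepend => //; split; last exact/avoids12_between_ascents.
exact: avoids4123_below_head.
Qed.

Lemma du4123_perm_ins m s u v : 0 < m -> v <= u ->
  du4123 m.+2 (perm_ins s (u, v)) <->
  du4123 m s /\ admissible (head 0 s) (ascents s) (u, v).
Proof.
move=> m_gt0 le_vu.
have perm_is :
    perm_eq (perm_ins s (u, v)) (iota 1 m.+2) = (u <= m) && perm_eq s (iota 1 m).
  by rewrite /perm_ins !prepend_perm_iota1 andbA; congr (_ && _) => /=; lia.
have s_gt0 : perm_eq s (iota 1 m) -> 0 < size s by move/perm_size->; rewrite size_iota.
split=> [[]|[[perm_s alt av] adm]].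
  rewrite perm_is => /andP[le_um perm_s]; rewrite alternates_perm_ins ?s_gt0 //.
  case/andP=> lt_vp alt; have /perm_iota1P[Us mem_s] := perm_s.
  case/avoids4123_perm_ins=> // x x_range; rewrite mem_s; lia.
have [_ le_up lt_vp _] := adm; have /perm_iota1P[Us mem_s] := perm_s.
have /andP[_ le_pm] : 0 < head 0 s <= m by rewrite -mem_s -nth0 mem_nth ?s_gt0.
split.
- by rewrite perm_is perm_s (leq_trans le_up).
- by rewrite alternates_perm_ins ?s_gt0 // lt_vp.
- by apply/avoids4123_perm_ins => // x x_range; rewrite mem_s; lia.
Qed.

Lemma perm_ins_surj m s : du4123 m.+2 s ->
  exists s' u v, v <= u /\ s = perm_ins s' (u, v).
Proof.
case; case: s => [|a [|b r]]; try by move/perm_size; rewrite size_iota.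
case/perm_iota1P=> Us mem_s /andP[lt_ba _] _.
have b_gt0 : 0 < b by move: (mem_s b); rewrite !inE eqxx orbT; lia.
have [u def_a] : exists u, a = u.+2 by exists (a - 2); lia.
have [v def_b] : exists v, b = v.+1 by exists b.-1; lia.
have eq_ba : unbump a b = b by rewrite /unbump; lia.
have /andP[/prepend_unbump def_s _] := Us.
exists (map (unbump b) (map (unbump a) r)), u, v; split; first by lia.
move: Us; rewrite -def_s prepend_uniq /= eq_ba => /andP[b_r _].
by rewrite /perm_ins -def_a -def_b prepend_unbump.
Qed.

Lemma ascents_perm_ins m s c : du4123 m s -> admissible (head 0 s) (ascents s) c ->
  ascents (perm_ins s c) =1 child_set (ascents s) c.
Proof.
case: c => u v [/perm_iota1P[Us mem_s] _ _] [le_vu le_up lt_vp no_asc] k.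
have bump2_inj : injective (bump2 u v) by move=> x y /bump_inj/bump_inj.
have s_gt0 : 0 < size s by case: (s) lt_vp.
have /andP[_ le_pm] : 0 < head 0 s <= m by rewrite -mem_s -nth0 mem_nth.
have subE x y x' y' : bump2 u v x = x' -> bump2 u v y = y' ->
    subseq [:: x'; y'] (map (bump2 u v) s) = subseq [:: x; y] s.
  by move=> <- <-; rewrite -(subseq_map_inj [:: x; y] s bump2_inj).
rewrite perm_insE // /ascents /child_set 2!subseq_cons2 sub1seq [head 0 _]/= addn2 !ltnS.
case: (posnP k) => // k_gt0; rewrite !orFb.
have [le_ku|lt_uk] := leqP k u; last by rewrite andbF; lia.
have /negPf-> : k != u.+2 by lia.
rewrite andbT; case: (ltngtP k v) => [lt_kv|lt_vk|->] /=.
- have /negPf-> : k != v.+1 by lia.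
  have -> : k.+1 < head 0 s by lia.
  by rewrite (subE k k.+1) ?andbF ?orbF ?andbT // /bump2 /bump; lia.
- have [def_k|neq_kv] := eqVneq k v.+1; last first.
    rewrite andbF (subE k.-1 k) /bump2 /bump; [|lia..].
    apply/negP => sub_k; have neq_kp : _ != head 0 s := subseq2_neq_head 0 Us sub_k.
    by have := no_asc k.-1; rewrite /ascents prednK // sub_k; lia.
  have -> : k.+1 = bump2 u v k by rewrite /bump2 /bump; lia.
  rewrite sub1seq (mem_map bump2_inj) mem_s; lia.
- rewrite [v == v.+1]ltn_eqF // andbF; apply/negP => /mem_subseq/(_ v.+1).
  rewrite !inE eqxx orbT => /(_ isT)/mapP[x _]; rewrite /bump2 /bump; lia.
Qed.

Lemma du4123_root s : du4123 1 s <-> s = [:: 1].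
Proof.
split=> [[perm_s _ _]|->]; first exact: perm_small_eq perm_s.
by split=> // a b c d /size_subseq.
Qed.

Lemma ascents_root : ascents [:: 1] =1 pred1 0.
Proof. by case=> [|k]; rewrite // /ascents /= addn2 andbF. Qed.

Lemma double_predSS n : 2 * n.+2 - 1 = (2 * n.+1 - 1).+2.
Proof. lia. Qed.

Definition perm_tree : gen_tree (nat * nat).
Proof.
refine (@GenTree _ (seq nat) [:: 1] (fun n => du4123 (2 * n.+1 - 1))
  (fun s => admissible (head 0 s) (ascents s)) perm_ins du4123_root _ _ _).
- move=> n s [u v] du adm; have [le_vu _ _ _] := adm.
  by rewrite double_predSS; apply/du4123_perm_ins => //; lia.
- move=> n s; rewrite double_predSS => /[dup] du.
  case/perm_ins_surj=> t [u [v [le_vu def_s]]].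
  by exists t, (u, v); move: du; rewrite def_s => /du4123_perm_ins[] //; lia.
- by move=> n s c s' c' _ _ _ _; apply: perm_ins_inj.
Defined.

(** * Positions and prefix counts *)

Section LetterCounts.
Variable T : eqType.
Implicit Types (x y l : T) (w u v : seq T).

Lemma count_mem_index x w : count_mem x w + index x w <= size w.
Proof.
elim: w => //= z w IHw; case: eqP => _ /=; last by rewrite add0n addnS ltnS.
by rewrite addn0 add1n ltnS count_size.
Qed.

Lemma notin_take_index x w i : i <= index x w -> x \notin take i w.
Proof. by move=> le_i; apply/negP => /index_ltn; rewrite ltnNge le_i. Qed.

Lemma nth_eq_index x0 x w i :
  x \in w -> i <= index x w -> (nth x0 w i == x) = (i == index x w).
Proof.
move=> w_x; rewrite leq_eqVlt => /predU1P[->|lt_i]; first by rewrite nth_index ?eqxx.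
by rewrite [LHS](before_find x0 lt_i) (ltn_eqF lt_i).
Qed.

(* The accumulators a and b count the letters x and y read before w. *)
Definition dominates (m : nat) (x y : T) (a b : nat) (w : seq T) : Prop :=
  forall i, minn (b + count_mem y (take i w)) m <= a + count_mem x (take i w).

Lemma dominates_cons m x y a b l w : dominates m x y a b (l :: w) <->
  minn b m <= a /\ dominates m x y (a + (l == x)) (b + (l == y)) w.
Proof.
split=> [dom|[dom0 dom] [|i]].
- split=> [|i]; first by have := dom 0; rewrite /= !addn0.
  by have := dom i.+1; rewrite /= !addnA.
- by rewrite /= !addn0.
- by rewrite /= !addnA.
Qed.

Lemma dominates_cat m x y a b u v : dominates m x y a b (u ++ v) <->
  dominates m x y a b u /\
  dominates m x y (a + count_mem x u) (b + count_mem y u) v.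
Proof.
elim: u a b => [|l u IHu] a b /=.
  rewrite !addn0; split=> [dom|[]//]; split=> // i.
  by have := dom 0; rewrite take0.
split=> [/dominates_cons[dom0 /IHu[dom_u dom_v]]|[/dominates_cons[dom0 dom_u] dom_v]].
  by rewrite !addnA; split=> //; apply/dominates_cons.
by apply/dominates_cons; split=> //; apply/IHu; rewrite -!addnA.
Qed.

Lemma dominatesS m x y a b w :
  dominates m.+1 x y a.+1 b.+1 w <-> dominates m x y a b w.
Proof. by split=> dom i; have := dom i; rewrite !addSn minnSS. Qed.

Lemma leq_dominates m m' x y a b w :
  m' <= m -> dominates m x y a b w -> dominates m' x y a b w.
Proof. by move=> le_m'm dom i; have := dom i; lia. Qed.

Lemma leq_count_mem2 x y w : x != y -> count_mem x w + count_mem y w <= size w.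
Proof.
move=> neq_xy; rewrite -count_predUI [count (predI _ _) _](@eq_count _ _ pred0).
  by rewrite count_pred0 addn0 count_size.
by move=> z /=; case: eqP => // ->; apply: negPf.
Qed.

(* The two conditions differ only once m letters x and m.+1 letters y are read. *)
Lemma dominates_raise m x y w : x != y -> size w <= m.*2 ->
  dominates m x y 0 0 w -> dominates m.+1 x y 0 0 w.
Proof.
move=> neq_xy le_w dom i; have := dom i; have := leq_count_mem2 (take i w) neq_xy.
have : size (take i w) <= size w by rewrite size_take_min geq_minr.
lia.
Qed.

Lemma dominates_notin m x y u v : y \notin u ->
  dominates m x y 0 0 (u ++ v) <-> dominates m x y (count_mem x u) 0 v.
Proof.
move=> y_u; have no_y w : {subset w <= u} -> count_mem y w = 0.
  by move=> sub_wu; apply/count_memPn/(contra _ y_u)/sub_wu.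
split=> [/dominates_cat[_]|dom]; first by rewrite no_y.
apply/dominates_cat; rewrite no_y //; split=> // i.
by rewrite no_y ?min0n // => z; apply: mem_take.
Qed.

Lemma dominates_del_inert m x y a b u l v : l != x -> l != y ->
  dominates m x y a b (u ++ l :: v) <-> dominates m x y a b (u ++ v).
Proof.
move=> /negPf l_x /negPf l_y.
split=> /dominates_cat[dom_u dom_v]; apply/dominates_cat; split=> //.
  by move/dominates_cons: dom_v; rewrite l_x l_y !addn0 => -[].
apply/dominates_cons; rewrite l_x l_y !addn0; split=> //.
by have := dom_v 0; rewrite take0 /= !addn0.
Qed.

Lemma dominates_del_pair m x y u v : x != y ->
  dominates m.+1 x y 0 0 (u ++ [:: x, y & v]) -> dominates m x y 0 0 (u ++ v).
Proof.
move=> /negPf neq_xy /dominates_cat[/(leq_dominates (leqnSn m)) dom_u] /dominates_cons[_].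
rewrite eqxx neq_xy => /dominates_cons[_]; rewrite eqxx eq_sym neq_xy !addn0 !addn1.
by move/dominatesS=> dom_v; apply/dominates_cat.
Qed.

Lemma dominates_ins_pair m x y u v : x != y -> size u <= m.*2 ->
  dominates m x y 0 0 (u ++ v) -> dominates m.+1 x y 0 0 (u ++ [:: x, y & v]).
Proof.
move=> neq_xy size_u /dominates_cat[dom_u dom_v].
have dom_u' := dominates_raise neq_xy size_u dom_u; apply/dominates_cat; split=> //.
have := dom_u' (size u); rewrite take_size => end_u.
apply/dominates_cons; rewrite eqxx (negPf neq_xy); split=> //.
apply/dominates_cons; rewrite eqxx eq_sym (negPf neq_xy) !addn0 !addn1.
by split; [lia | apply/dominatesS].
Qed.

Lemma dominates_split_pair m x y u v w : x != y -> y \notin u ++ v ->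
  dominates m.+1 x y 0 0 (u ++ x :: v ++ y :: w) <-> dominates m x y 0 0 (u ++ v ++ w).
Proof.
move=> neq_xy y_uv; have y_uxv : y \notin u ++ x :: v.
  by move: y_uv; rewrite !mem_cat inE !negb_or eq_sym neq_xy.
rewrite -cat_cons !catA; apply: iff_trans (dominates_notin _ _ _ y_uxv) _.
apply: iff_trans _ (iff_sym (dominates_notin _ _ _ y_uv)).
rewrite !count_cat /= eqxx add1n addnS.
split=> [/dominates_cons[_]|dom_w]; last apply/dominates_cons.
  by rewrite eqxx eq_sym (negPf neq_xy) addn0 => /dominatesS.
by rewrite eqxx eq_sym (negPf neq_xy) addn0 min0n; split=> //; apply/dominatesS.
Qed.

End LetterCounts.

Lemma positions_cons x y w :
  positions x (y :: w) = nseq (y == x) 0 ++ map S (positions x w).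
Proof. by rewrite /positions /= -(addn0 1) iotaDl filter_map; case: (y == x). Qed.

Lemma size_positions x w : size (positions x w) = count_mem x w.
Proof.
by elim: w => // y w IHw; rewrite positions_cons size_cat size_nseq size_map IHw.
Qed.

Lemma nth_positions_ltn x w j i : j < count_mem x w ->
  (nth 0 (positions x w) j < i) = (j < count_mem x (take i w)).
Proof.
elim: w j i => // y w IHw j [|i]; rewrite positions_cons /=; first by rewrite !ltn0.
case: (y == x); rewrite /= ?add0n ?add1n => lt_jw; last first.
  by rewrite (nth_map 0) ?size_positions // ltnS IHw.
by case: j lt_jw => // j lt_jw; rewrite /= (nth_map 0) ?size_positions // !ltnS IHw.
Qed.

Lemma nth_positionsK x w j : j < count_mem x w -> nth 0 w (nth 0 (positions x w) j) = x.
Proof.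
by rewrite -size_positions => /(mem_nth 0); rewrite mem_filter => /andP[/eqP].
Qed.

Lemma dominates_positions m x y w : x != y ->
  m <= count_mem x w -> m <= count_mem y w ->
  dominates m x y 0 0 w <->
  (forall j, j < m -> nth 0 (positions x w) j < nth 0 (positions y w) j).
Proof.
move=> neq_xy le_mx le_my; split=> [dom j lt_jm|lt_pos i]; last first.
  case def_min: (minn _ _) => [//|j]; have lt_jm : j < m by lia.
  rewrite add0n -nth_positions_ltn; last by lia.
  by apply: ltn_trans (lt_pos j lt_jm) _; rewrite nth_positions_ltn; lia.
have [lt_jx lt_jy] : j < count_mem x w /\ j < count_mem y w by lia.
set q := nth 0 (positions y w) j.
have lt_jq : j < count_mem y (take q.+1 w) by rewrite -nth_positions_ltn.
have : nth 0 (positions x w) j < q.+1.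
  by rewrite nth_positions_ltn //; have := dom q.+1; lia.
rewrite ltnS leq_eqVlt => /predU1P[eq_pos|//].
by move: neq_xy; rewrite -(nth_positionsK lt_jx) eq_pos nth_positionsK // eqxx.
Qed.

(** * Skew Yamanouchi words *)

Definition skew_dominated (n : nat) (w : seq nat) : Prop :=
  [/\ has_type n n.+1 n.+2 w, dominates n 1 2 0 0 w & dominates n.+1 2 3 0 0 w].

Lemma skew_yamanouchiP n w : reflect (skew_dominated n w) (skew_yamanouchi n.+1 w).
Proof.
rewrite /skew_yamanouchi /skew_dominated subn1 addn1 /=.
have [type_w|_] /= := boolP (has_type _ _ _ w); last by right; case.
have /and4P[_ /eqP c1 /eqP c2 /eqP c3] := type_w.
have := @dominates_positions n 1 2 w isT; rewrite c1 c2.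
move/(_ (leqnn _) (leqnSn _)) => dom12.
have := @dominates_positions n.+1 2 3 w isT; rewrite c2 c3.
move/(_ (leqnn _) (leqnSn _)) => dom23.
apply: (iffP andP) => [[lt_bc /forallP lt_abc]|[_ /dom12 lt_ab /dom23 lt_bc]].
  split=> //; [apply/dom12 => j lt_jn|apply/dom23 => j].
    by case/andP: (lt_abc (Ordinal lt_jn)).
  rewrite ltnS leq_eqVlt => /predU1P[->//|lt_jn].
  by case/andP: (lt_abc (Ordinal lt_jn)).
rewrite lt_bc //; split=> //; apply/forallP => j.
by rewrite lt_ab // lt_bc // ltnS ltnW.
Qed.

Lemma skew_dominated_valP n w :
  skew_dominated n w <-> exists w' : {w : seq nat | skew_yamanouchi n.+1 w}, val w' = w.
Proof.
split=> [/skew_yamanouchiP skew_w|[[w' skew_w] <-]]; last exact/skew_yamanouchiP.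
by exists (Sub w skew_w).
Qed.

Definition word_ins (t : seq nat) (c : nat * nat) : seq nat :=
  let: (u, v) := c in take v t ++ [:: 1, 2 & take (u - v) (drop v t) ++ 3 :: drop u t].

Lemma cat_take_drop2 (T : Type) u v (t : seq T) : v <= u ->
  take v t ++ take (u - v) (drop v t) ++ drop u t = t.
Proof. by move=> le_vu; rewrite catA -takeD subnKC // cat_take_drop. Qed.

Lemma perm_word_ins t u v : v <= u ->
  perm_eq (word_ins t (u, v)) [:: 1, 2, 3 & t].
Proof.
move=> le_vu; apply/seq.permP => a.
have := congr1 (count a) (cat_take_drop2 t le_vu).
by rewrite /word_ins !count_cat /= count_cat /=; lia.
Qed.

Lemma has_type_word_ins c1 c2 c3 t u v : v <= u ->
  has_type c1.+1 c2.+1 c3.+1 (word_ins t (u, v)) = has_type c1 c2 c3 t.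
Proof.
move=> /(perm_word_ins t) perm_t.
by rewrite /has_type (perm_all _ perm_t) !(seq.permP perm_t) /= !add0n !add1n !eqSS.
Qed.

Section NthWordIns.
Variables (t : seq nat) (u v : nat).
Hypotheses (le_vu : v <= u) (le_ut : u <= size t).

Let le_vt : v <= size t. Proof. exact: leq_trans le_ut. Qed.

Let le_uvt : u - v <= size (drop v t). Proof. by rewrite size_drop; lia. Qed.

Lemma size_word_ins : size (word_ins t (u, v)) = (size t).+3.
Proof. by rewrite (perm_size (perm_word_ins t le_vu)). Qed.

Lemma nth_word_ins_lt k : k < v -> nth 0 (word_ins t (u, v)) k = nth 0 t k.
Proof. by move=> lt_kv; rewrite nth_cat size_takel // lt_kv nth_take. Qed.

Lemma nth_word_ins_at : nth 0 (word_ins t (u, v)) v = 1.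
Proof. by rewrite nth_cat size_takel // ltnn subnn. Qed.

Lemma nth_word_ins_atS : nth 0 (word_ins t (u, v)) v.+1 = 2.
Proof. by rewrite nth_cat size_takel // ltnNge leqnSn subSnn. Qed.

Lemma nth_word_ins_mid k : v <= k < u -> nth 0 (word_ins t (u, v)) k.+2 = nth 0 t k.
Proof.
case/andP=> le_vk lt_ku; rewrite nth_cat size_takel // ltnNge !leqW //= !subSn ?leqW //=.
rewrite nth_cat size_takel // ltn_sub2r ?(leq_ltn_trans le_vk) //.
by rewrite nth_take ?nth_drop ?subnKC //; lia.
Qed.

Lemma nth_word_ins_ge k : u <= k -> nth 0 (word_ins t (u, v)) k.+3 = nth 0 t k.
Proof.
move=> le_uk; have le_vk := leq_trans le_vu le_uk.
rewrite nth_cat size_takel // ltnNge !leqW //= !subSn ?leqW //=.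
rewrite nth_cat size_takel // ltnNge leqW ?leq_sub2r //=.
by rewrite subSn ?leq_sub2r //= nth_drop; congr nth; lia.
Qed.

End NthWordIns.

Lemma leq_alpha_size t u : u <= alpha t -> u <= size t.
Proof. by move/leq_trans; apply; apply: index_size. Qed.

Lemma alpha_word_ins t u v : v <= u -> u <= alpha t -> alpha (word_ins t (u, v)) = u.+2.
Proof.
move=> le_vu le_ua; have le_ut := leq_alpha_size le_ua.
have := notin_take_index le_ua; rewrite -(subnKC le_vu) takeD mem_cat negb_or subnKC //.
case/andP=> /negPf x3 /negPf y3.
rewrite /alpha index_cat x3 /= index_cat y3 /= !size_takel ?size_drop; lia.
Qed.

(* Positions count from 0 here, whereas the elements of setB count from 1. *)
Definition factor12 (w : seq nat) (k : nat) : bool :=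
  (nth 0 w k == 1) && (nth 0 w k.+1 == 2).

Lemma setB_S w k : setB w k.+1 = factor12 w k && (k.+3 <= alpha w).
Proof. by rewrite /setB /= addn2 andbA. Qed.

Lemma factor12_word_ins_lt t u v k : v <= u -> u <= size t -> k.+1 < v ->
  factor12 (word_ins t (u, v)) k = factor12 t k.
Proof. by move=> le_vu le_ut lt_kv; rewrite /factor12 !nth_word_ins_lt // ltnW. Qed.

Lemma factor12_word_ins_pred t u v : v < u -> u <= size t ->
  factor12 (word_ins t (u, v.+1)) v = false.
Proof. by move=> lt_vu le_ut; rewrite /factor12 nth_word_ins_at // andbF. Qed.

Lemma factor12_word_ins_eq t u v : v <= u -> u <= size t ->
  factor12 (word_ins t (u, v)) v.
Proof. by move=> le_vu le_ut; rewrite /factor12 nth_word_ins_at ?nth_word_ins_atS. Qed.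

Lemma factor12_word_ins_gt t u v k : v <= u -> u <= size t -> v < k <= u ->
  factor12 (word_ins t (u, v)) k = (v.+1 < k) && factor12 t (k - 2).
Proof.
move=> le_vu le_ut /andP[lt_vk le_ku]; rewrite /factor12.
have [<-|neq_k] := eqVneq v.+1 k; first by rewrite nth_word_ins_atS ?ltnn.
have [j def_k] : exists j, k = j.+2 by exists (k - 2); lia.
have -> : v.+1 < k by lia.
rewrite def_k subn2 /= !nth_word_ins_mid //; lia.
Qed.

(* The boolean summand excludes the last letter of an initial run followed by 33. *)
Definition removable (s : seq nat) (k : nat) : bool :=
  factor12 s k && (k.+2 + (nth 0 s (alpha s).+1 == 3) <= alpha s).

Lemma admissible_removable t u v : 3 \in t -> v <= u -> u <= alpha t ->
  admissible (alpha t) (setB t) (u, v) <->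
  removable (word_ins t (u, v)) v /\
  forall k, removable (word_ins t (u, v)) k -> k <= v.
Proof.
move=> t3 le_vu le_ua; have le_ut := leq_alpha_size le_ua.
rewrite /removable alpha_word_ins // nth_word_ins_ge //.
rewrite nth_eq_index // -/(alpha t).
rewrite factor12_word_ins_eq //=; split=> [[_ _ lt_va noB]|[lt_v v_max]].
  split=> [|k /andP[factor_k le_k]]; first by lia.
  rewrite leqNgt; apply/negP => lt_vk; move: factor_k.
  rewrite factor12_word_ins_gt //; last by lia.
  case/andP=> lt_v1k factor_t; have /noB : v < (k - 2).+1 < u by lia.
  by rewrite setB_S factor_t; lia.
split=> //; first by lia.
case=> [|k] k_range; first by lia.
apply/negP; rewrite setB_S => /andP[factor_t le_k].
have := v_max k.+2; rewrite factor12_word_ins_gt // ?subn2 ?factor_t; lia.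
Qed.

Lemma setB_word_ins t c : admissible (alpha t) (setB t) c ->
  setB (word_ins t c) =1 child_set (setB t) c.
Proof.
case: c => u v [le_vu le_ua lt_va noB] [//|k]; have le_ut := leq_alpha_size le_ua.
rewrite /child_set !setB_S alpha_word_ins // eqSS !ltnS.
case: (ltngtP k v) => [lt_kv|lt_vk|->].
- rewrite andbF orbF /=; have [def_v|neq_k1v] := eqVneq k.+1 v.
    by subst v; rewrite factor12_word_ins_pred ?ltnn.
  have lt_k1v : k.+1 < v by rewrite ltn_neqAle neq_k1v.
  rewrite factor12_word_ins_lt // lt_k1v.
  by rewrite (leq_trans lt_kv le_vu) (leq_ltn_trans lt_k1v lt_va).
- rewrite andbF orbF /= (_ : k.+1 < v = false); last by lia.
  apply/negP => /andP[+ lt_ku]; rewrite factor12_word_ins_gt //; last by lia.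
  case/andP=> lt_v1k factor_t; have /noB : v < (k - 2).+1 < u by lia.
  by rewrite setB_S factor_t; lia.
- by rewrite factor12_word_ins_eq // (_ : v.+1 < v = false) ?andbT; last by lia.
Qed.

Lemma word_ins_inj t t' u v : v <= u -> u <= size t -> u <= size t' ->
  word_ins t (u, v) = word_ins t' (u, v) -> t = t'.
Proof.
move=> le_vu le_ut le_ut' eq_ins.
have eq_size : size t = size t'.
  by have := congr1 size eq_ins; rewrite !size_word_ins // => -[].
apply: (@eq_from_nth _ 0) => // k _; case: (ltnP k v) => [lt_kv|le_vk].
  by have := congr1 (fun s => nth 0 s k) eq_ins; rewrite !nth_word_ins_lt.
case: (ltnP k u) => [lt_ku|le_uk].
  by have := congr1 (fun s => nth 0 s k.+2) eq_ins; rewrite !nth_word_ins_mid ?le_vk.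
by have := congr1 (fun s => nth 0 s k.+3) eq_ins; rewrite !nth_word_ins_ge.
Qed.

Lemma admissible_word_ins_inj t c t' c' : 3 \in t -> 3 \in t' ->
  admissible (alpha t) (setB t) c -> admissible (alpha t') (setB t') c' ->
  word_ins t c = word_ins t' c' -> t = t' /\ c = c'.
Proof.
case: c c' => [u v] [u' v'] t3 t3' adm adm' eq_ins.
have [[le_vu le_ua _ _] [le_vu' le_ua' _ _]] := (adm, adm').
have [rem_v v_max] := (admissible_removable t3 le_vu le_ua).1 adm.
have [rem_v' v_max'] := (admissible_removable t3' le_vu' le_ua').1 adm'.
have eq_v : v = v'.
  by apply/eqP; rewrite eqn_leq v_max' -?eq_ins // v_max ?eq_ins.
have eq_u : u = u'.
  by have := alpha_word_ins le_vu le_ua; rewrite eq_ins alpha_word_ins // => -[].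
subst u' v'; split=> //.
by apply: (word_ins_inj le_vu) eq_ins; apply: leq_alpha_size.
Qed.

Lemma word_ins_cat x y z :
  word_ins (x ++ y ++ z) (size x + size y, size x) = x ++ [:: 1, 2 & y ++ 3 :: z].
Proof.
rewrite /word_ins take_size_cat // drop_size_cat // addKn take_size_cat //.
by rewrite catA drop_size_cat // size_cat.
Qed.

Lemma word_ins_surj s u v : v <= u -> u.+2 < size s ->
  factor12 s v -> nth 0 s u.+2 = 3 ->
  exists2 t, u <= size t & s = word_ins t (u, v).
Proof.
move=> le_vu lt_us /andP[/eqP s1 /eqP s2] s3.
pose x := take v s; pose y := take (u - v) (drop v.+2 s); pose z := drop u.+3 s.
have size_x : size x = v by rewrite size_takel //; lia.
have size_y : size y = u - v by rewrite size_takel // size_drop; lia.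
have def_s : s = x ++ [:: 1, 2 & y ++ 3 :: z].
  have [lt_vs lt_v1s] : v < size s /\ v.+1 < size s by lia.
  rewrite -{1}(cat_take_drop v s) (drop_nth 0 lt_vs) (drop_nth 0 lt_v1s) s1 s2.
  rewrite -{1}(cat_take_drop (u - v) (drop v.+2 s)) drop_drop.
  by rewrite !addnS subnK // (drop_nth 0 lt_us) s3.
exists (x ++ y ++ z); first by rewrite !size_cat size_x size_y; lia.
by rewrite def_s -word_ins_cat size_x size_y subnKC.
Qed.

Lemma size_has_type c1 c2 c3 w : has_type c1 c2 c3 w -> size w = c1 + c2 + c3.
Proof.
case/and4P=> + /eqP<- /eqP<- /eqP<-.
elim: w => //= l w IHw /andP[+ /IHw->]; rewrite !inE.
by case/or3P=> /eqP-> /=; lia.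
Qed.

Lemma leq_alpha_has_type c1 c2 c3 w : has_type c1 c2 c3 w -> alpha w <= c1 + c2.
Proof.
move=> type_w; have := count_mem_index 3 w; rewrite (size_has_type type_w) /alpha.
by case/and4P: type_w => _ _ _ /eqP->; lia.
Qed.

Lemma has_type_mem3 c1 c2 c3 w : has_type c1 c2 c3.+1 w -> 3 \in w.
Proof. by case/and4P=> _ _ _ /eqP c3P; rewrite -has_pred1 has_count c3P. Qed.

Lemma dominates12_word_ins m t u v : v <= u -> v <= m.*2 ->
  dominates m 1 2 0 0 t -> dominates m.+1 1 2 0 0 (word_ins t (u, v)).
Proof.
move=> le_vu le_vm dom; apply: dominates_ins_pair => //.
  by rewrite size_take_min (leq_trans (geq_minl _ _)).
by rewrite catA; apply/dominates_del_inert; rewrite // -catA cat_take_drop2.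
Qed.

Lemma dominates12_word_del m t u v : v <= u ->
  dominates m.+1 1 2 0 0 (word_ins t (u, v)) -> dominates m 1 2 0 0 t.
Proof.
move=> le_vu /dominates_del_pair -/(_ isT); rewrite catA => /dominates_del_inert.
by rewrite -catA cat_take_drop2 //; apply.
Qed.

Lemma dominates23_word_ins m t u v : v <= u -> u <= alpha t ->
  dominates m.+1 2 3 0 0 (word_ins t (u, v)) <-> dominates m 2 3 0 0 t.
Proof.
move=> le_vu le_ua; rewrite -{2}(cat_take_drop2 t le_vu).
apply: iff_trans (@dominates_del_inert _ _ 2 3 _ _ _ 1 _ isT isT) _.
apply: dominates_split_pair => //.
by rewrite -takeD subnKC // notin_take_index.
Qed.

Lemma skew_dominated_word_ins n t u v : v <= u -> u <= alpha t -> v < alpha t ->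
  skew_dominated n t -> skew_dominated n.+1 (word_ins t (u, v)).
Proof.
move=> le_vu le_ua lt_va [type_t dom12 dom23].
split; first by rewrite has_type_word_ins.
  by apply: dominates12_word_ins => //; have := leq_alpha_has_type type_t; lia.
exact/dominates23_word_ins.
Qed.

Lemma skew_dominated_word_del n t u v : v <= u -> u <= alpha t ->
  skew_dominated n.+1 (word_ins t (u, v)) -> skew_dominated n t.
Proof.
move=> le_vu le_ua [type_s dom12 dom23].
split; [by rewrite has_type_word_ins in type_s | exact: dominates12_word_del dom12 |].
exact/(dominates23_word_ins _ le_vu le_ua).
Qed.

Lemma count_mem2_initial_run n s : skew_dominated n.+1 s ->
  (nth 0 s (alpha s).+1 == 3) < count_mem 2 (take (alpha s) s).
Proof.
case=> type_s _ dom23; have s3 := has_type_mem3 type_s.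
have nth_a : nth 0 s (alpha s) = 3 by apply: nth_index.
have lt_as : alpha s < size s by rewrite index_mem.
have [/eqP nth_a1|_] := boolP (_ == 3); last first.
  have := dom23 (alpha s).+1; rewrite (take_nth 0 lt_as) nth_a -cats1 !count_cat /=; lia.
have lt_a1s : (alpha s).+1 < size s.
  by rewrite ltnNge; apply/negP => /(nth_default 0); rewrite nth_a1.
have := dom23 (alpha s).+2; rewrite (take_nth 0 lt_a1s) (take_nth 0 lt_as) nth_a nth_a1.
by rewrite -!cats1 !count_cat /=; lia.
Qed.

Lemma nth_pred_index2 n s : skew_dominated n.+1 s -> index 2 s < alpha s ->
  0 < index 2 s /\ nth 0 s (index 2 s).-1 = 1.
Proof.
case=> type_s dom12 _ lt_2a; have lt_2s := leq_trans lt_2a (index_size _ _).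
have nth_2 : nth 0 s (index 2 s) = 2 by apply: nth_index; rewrite -index_mem.
have index2_gt0 : 0 < index 2 s.
  have := dom12 (index 2 s).+1; rewrite (take_nth 0 lt_2s) nth_2 -cats1 !count_cat /=.
  by case: (index 2 s) => [|//]; rewrite take0 /=; lia.
split=> //; have lt_pred : (index 2 s).-1 < index 2 s by rewrite prednK.
have := before_find 0 lt_pred; have := before_find 0 (ltn_trans lt_pred lt_2a).
have /and4P[/allP/(_ (nth 0 s (index 2 s).-1)) + _ _ _] := type_s.
rewrite mem_nth ?(ltn_trans lt_pred) // => /(_ isT) /=.
by rewrite !inE => /or3P[]/eqP->.
Qed.

Lemma skew_dominated_removable n s : skew_dominated n.+1 s -> exists k, removable s k.
Proof.
move=> dom_s; have count_run := count_mem2_initial_run dom_s.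
have run2 : 2 \in take (alpha s) s by rewrite -has_pred1 has_count; lia.
have index_run : index 2 (take (alpha s) s) = index 2 s.
  by rewrite -{3}(cat_take_drop (alpha s) s) index_cat run2.
have := count_mem_index 2 (take (alpha s) s).
rewrite index_run size_takel ?index_size // => le_2a.
have [|index2_gt0 nth_pred] := nth_pred_index2 dom_s; first by lia.
exists (index 2 s).-1; rewrite /removable /factor12 prednK // nth_pred.
by rewrite nth_index ?(mem_take run2) //=; lia.
Qed.

Lemma word_ins_parent n s : skew_dominated n.+1 s ->
  exists t c, [/\ skew_dominated n t, admissible (alpha t) (setB t) c & s = word_ins t c].
Proof.
move=> dom_s; have [type_s _ _] := dom_s; have s3 := has_type_mem3 type_s.
have rem_bound k : removable s k -> k <= alpha s by case/andP; lia.
case: (ex_maxnP (skew_dominated_removable dom_s) rem_bound) => v rem_v v_max.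
have [factor_v le_va] := andP rem_v.
have [u def_u] : exists u, alpha s = u.+2 by exists (alpha s - 2); lia.
rewrite def_u in le_va.
have nth_u : nth 0 s u.+2 = 3 by rewrite -def_u nth_index.
have lt_us : u.+2 < size s by rewrite -def_u index_mem.
have le_vu : v <= u by lia.
have [t le_ut def_s] := word_ins_surj le_vu lt_us factor_v nth_u.
have le_ua : u <= alpha t.
  rewrite leqNgt; apply/negP => lt_au.
  have t3 : nth 0 t (alpha t) = 3.
    by apply: nth_index; rewrite -index_mem (leq_trans lt_au).
  have no3 k : k < u.+2 -> nth 0 s k != 3 by rewrite -def_u => /(before_find 0)/= ->.
  have [lt_av|le_va'] := ltnP (alpha t) v.
    by have := no3 (alpha t); rewrite def_s nth_word_ins_lt // t3; lia.
  by have := no3 (alpha t).+2; rewrite def_s nth_word_ins_mid ?t3 //; lia.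
have dom_t : skew_dominated n t.
  by apply: (skew_dominated_word_del le_vu le_ua); rewrite -def_s.
exists t, (u, v); split=> //; have [type_t _ _] := dom_t.
by apply/admissible_removable; rewrite -?def_s //; apply: has_type_mem3 type_t.
Qed.

Lemma skew_dominated_root w : skew_dominated 0 w <-> w = [:: 2; 3; 3].
Proof.
split=> [[type_w _ dom23]|->]; last first.
  by split=> // i; case: i => [|[|[|i]]].
have := dom23 1; have := size_has_type type_w; move: type_w.
case: w {dom23} => [|a [|b [|c []]]] //= type_w _; move: type_w => /and4P[].
by rewrite /= !inE !andbT => /and3P[/or3P[]/eqP-> /or3P[]/eqP-> /or3P[]/eqP->].
Qed.

Lemma setB_root : setB [:: 2; 3; 3] =1 pred1 0.
Proof. by case=> [|k]; rewrite // setB_S /= andbF. Qed.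

Definition word_tree : gen_tree (nat * nat).
Proof.
refine (@GenTree _ (seq nat) [:: 2; 3; 3] skew_dominated
  (fun w => admissible (alpha w) (setB w)) word_ins
  skew_dominated_root _ word_ins_parent _).
- by move=> n t [u v] dom_t [le_vu le_ua lt_va _]; apply: skew_dominated_word_ins.
- move=> n t c t' c' [type_t _ _] adm [type_t' _ _] adm'.
  by apply: admissible_word_ins_inj (has_type_mem3 type_t) (has_type_mem3 type_t') _ _.
Defined.

(** * One-line notation *)

Lemma size_one_line m (pi : 'S_m) : size (one_line pi) = m.
Proof. by rewrite /one_line size_map size_enum_ord. Qed.

Lemma nth_one_line m (pi : 'S_m) (i : 'I_m) : nth 0 (one_line pi) i = (pi i).+1.
Proof. by rewrite /one_line (nth_map i) ?size_enum_ord // nth_ord_enum. Qed.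

Lemma one_line_inj m : injective (@one_line m).
Proof.
move=> p q eq_pq; apply/permP => i; apply: val_inj.
by have := congr1 (nth 0 ^~ i) eq_pq; rewrite !nth_one_line => -[].
Qed.

Lemma one_line_perm_iota1 m (pi : 'S_m) : perm_eq (one_line pi) (iota 1 m).
Proof.
have Us : uniq (one_line pi).
  by rewrite map_inj_uniq ?enum_uniq // => i j [] /val_inj/perm_inj.
have sub_iota : {subset one_line pi <= iota 1 m}.
  by move=> _ /mapP[i _ ->]; rewrite mem_iota add1n !ltnS ltn_ord.
have [|_ mem_pi] := uniq_min_size Us sub_iota; first by rewrite size_iota size_one_line.
by apply: uniq_perm; rewrite ?iota_uniq.
Qed.

Lemma one_line_surj m (s : seq nat) : perm_eq s (iota 1 m) ->
  exists pi : 'S_m, one_line pi = s.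
Proof.
move=> perm_s; have size_s := perm_size perm_s; rewrite size_iota in size_s.
have [Us mem_s] := perm_iota1P _ _ perm_s.
have nth_bound (i : 'I_m) : 0 < nth 0 s i <= m by rewrite -mem_s mem_nth ?size_s.
have pred_bound (i : 'I_m) : (nth 0 s i).-1 < m by have := nth_bound i; lia.
have inj_pred : injective (fun i : 'I_m => Ordinal (pred_bound i)).
  move=> i j [] eq_ij; have eq_nth : nth 0 s i = nth 0 s j.
    by have := nth_bound i; have := nth_bound j; lia.
  by apply/val_inj/eqP; rewrite /= -(nth_uniq 0 _ _ Us) ?size_s ?eq_nth.
exists (perm inj_pred); apply: (@eq_from_nth _ 0); rewrite size_one_line // => i lt_im.
have /andP[nth_gt0 _] := nth_bound (Ordinal lt_im).
by rewrite (nth_one_line _ (Ordinal lt_im)) permE /= prednK.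
Qed.

Lemma subseq_enum_ord m (l : seq 'I_m) : subseq l (enum 'I_m) = sorted ltn (map val l).
Proof.
have trans_ltn : transitive (relpre val ltn : rel 'I_m) by move=> ? ? ?; apply: ltn_trans.
have sorted_enum : sorted (relpre val ltn) (enum 'I_m).
  by rewrite -sorted_map val_enum_ord iota_ltn_sorted.
rewrite sorted_map; apply/idP/idP => [sub_l|sorted_l].
  exact: subseq_sorted sub_l sorted_enum.
have -> : l = filter (mem l) (enum 'I_m).
  apply: (irr_sorted_eq trans_ltn) => // [i|| i]; [by rewrite /= ltnn| |].
    exact: sorted_filter.
  by rewrite mem_filter mem_enum andbT.
exact: filter_subseq.
Qed.

Lemma subseq_one_lineP m (pi : 'S_m) s :
  reflect (exists2 l : seq 'I_m, sorted ltn (map val l) & s = [seq (pi i).+1 | i <- l])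
          (subseq s (one_line pi)).
Proof.
apply: (iffP (subseq_mapP _ _ _)) => -[l].
  by rewrite subseq_enum_ord; exists l.
by rewrite -subseq_enum_ord; exists l.
Qed.

Lemma down_up_one_line m (pi : 'S_m) : down_up pi = alternates true (one_line pi).
Proof.
apply/forallP/alternatesP => [du i|alt i]; last first.
  apply/forallP => j; apply/implyP => /eqP def_j.
  have := alt i; rewrite size_one_line -def_j ltn_ord !nth_one_line !ltnS => /(_ isT).
  by rewrite addbT; case: (odd i).
rewrite size_one_line => lt_i1m; have lt_im := ltnW lt_i1m.
have /forallP/(_ (Ordinal lt_i1m))/implyP/(_ (eqxx _)) := du (Ordinal lt_im).
have := nth_one_line pi (Ordinal lt_im); have := nth_one_line pi (Ordinal lt_i1m).
by move=> /= -> ->; rewrite !ltnS addbT; case: (odd i).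
Qed.

Lemma avoids4123_one_line m (pi : 'S_m) :
  ~~ contains4123 pi <-> avoids4123 (one_line pi).
Proof.
split=> [no_pat a b c d /subseq_one_lineP[]|av].
  case=> [|i1 [|i2 [|i3 [|i4 []]]]] //= /and4P[lt12 lt23 lt34 _] [-> -> -> ->].
  apply: contra no_pat; rewrite !ltnS => /and3P[lt_pi23 lt_pi34 lt_pi41].
  apply/existsP; exists i1; apply/existsP; exists i2.
  apply/existsP; exists i3; apply/existsP; exists i4.
  by rewrite lt12 lt23 lt34 lt_pi23 lt_pi34.
apply/negP => /existsP[i1 /existsP[i2 /existsP[i3 /existsP[i4]]]].
case/and5P=> lt12 lt23 lt34 lt_pi23 /andP[lt_pi34 lt_pi41].
have sub_pi : subseq [seq (pi i).+1 | i <- [:: i1; i2; i3; i4]] (one_line pi).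
  by apply/subseq_one_lineP; exists [:: i1; i2; i3; i4]; rewrite //= lt12 lt23 lt34.
by have := av _ _ _ _ sub_pi; rewrite !ltnS lt_pi23 lt_pi34 lt_pi41.
Qed.

Lemma du4123_one_line m (pi : 'S_m) : pi \in DU4123 m <-> du4123 m (one_line pi).
Proof.
rewrite inE down_up_one_line; split=> [/andP[alt /avoids4123_one_line av]|[_ alt]].
  by split=> //; apply: one_line_perm_iota1.
by move/avoids4123_one_line=> no_pat; apply/andP.
Qed.

Lemma du4123_one_lineP m s :
  du4123 m s <-> exists p : {p : 'S_m | p \in DU4123 m}, one_line (val p) = s.
Proof.
split=> [du_s|[[pi du_pi] <-]]; last exact/du4123_one_line.
have [perm_s _ _] := du_s; have [pi def_s] := one_line_surj perm_s.
rewrite -def_s in du_s; have du_pi : pi \in DU4123 m by apply/du4123_one_line.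
by exists (Sub pi du_pi).
Qed.

Lemma setA_one_line m (pi : 'S_m) : setA pi =1 ascents (one_line pi).
Proof.
move=> k; rewrite /setA /ascents /=; congr (_ || _); apply/existsP/andP.
  case=> i /existsP[j /and4P[lt_ij /eqP def_k /eqP def_k1 le_k]]; split=> //.
  by apply/subseq_one_lineP; exists [:: i; j]; rewrite /= ?lt_ij // def_k def_k1.
case=> /subseq_one_lineP[[|i [|j []]] //= /andP[lt_ij _] [def_k def_k1]] le_k.
by exists i; apply/existsP; exists j; rewrite lt_ij -def_k -def_k1 !eqxx.
Qed.

(** * The bijection *)

Definition same_label (s : node perm_tree) (w : node word_tree) : Prop :=
  head 0 s = alpha w /\ ascents s =1 setB w.

Lemma same_label_bisimulation : bisimulation same_label.
Proof.
split=> [|s w c [eq_head eq_set]|n s w c du_s _ adm_s adm_w [eq_head eq_set]].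
- by split=> // k; rewrite ascents_root setB_root.
- by rewrite /= eq_head; apply: eq_admissible.
split=> [|k]; last first.
  by rewrite (ascents_perm_ins du_s adm_s) (setB_word_ins adm_w); apply: eq_child_set.
by case: c {adm_s} adm_w => u v [le_vu le_ua _ _]; rewrite /= alpha_word_ins.
Qed.

Theorem theorem2p7 (n : nat) (hn : 1 <= n) :
  exists psi : {p : 'S_(2 * n - 1) | p \in DU4123 (2 * n - 1)} ->
               {w : seq nat | skew_yamanouchi n w},
    bijective psi /\
    forall p : {p : 'S_(2 * n - 1) | p \in DU4123 (2 * n - 1)},
      first_entry (val p) = alpha (val (psi p)) /\
      setA (val p) =i setB (val (psi p)).
Proof.
case: n hn => // n _.
have [psi [psi_bij same]] := bisim_level_bijection same_label_bisimulation
  (inj_comp (@one_line_inj _) val_inj) val_inj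
  (@du4123_one_lineP _) (@skew_dominated_valP n).
exists psi; split=> // p; have [eq_head eq_set] := same p.
by split=> // k; rewrite -!topredE /= setA_one_line eq_set.
Qed.
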